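(* For $n\geq 1$, with $N_n(t,q,r)=\sum_{\sigma\in\mathfrak{S}_n(321)}t^{\mathsf{exc}\,\sigma}q^{\mathsf{inv}\,\sigma}r^{\mathsf{fix}\,\sigma}$, $$N_n(t, q, t)=\sum_{k=1}^{\lfloor\frac{n+1}{2}\rfloor}\widetilde\gamma_{n-1, k-1}(q)t^k(1+t/q)^{n+1-2k},$$ where $$\widetilde{\gamma}_{n-1, k-1}(q)=\sum_{\pi\in\widetilde{\mathfrak{S}}_{n-1,k-1}(321)}q^{n-1+\mathsf{inv}\,\pi-\mathsf{exc}\,\pi}=\sum_{\pi\in\widetilde{\mathfrak{S}}_{n-1,k-1}(231)}q^{n-1+(31\text{-}2)\pi}=\sum_{\pi\in\widetilde{\mathfrak{S}}_{n-1,k-1}(312)}q^{n-1+(2\text{-}31)\pi}=\sum_{\pi\in\widetilde{\mathfrak{S}}_{n-1,k-1}(132)}q^{n-1+(2\text{-}13)\pi}=\sum_{\pi\in\widetilde{\mathfrak{S}}_{n-1,k-1}(213)}q^{n-1+(13\text{-}2)\pi}.$$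
   Context: $\mathfrak{S}_m(\tau)$ is the set of permutations of $[m]$ avoiding the classical pattern $\tau$. For $\sigma\in\mathfrak{S}_m$: $\mathsf{exc},\mathsf{fix},\mathsf{inv}$ are the numbers of excedances ($\sigma(i)>i$), fixed points and inversions; $\mathsf{des}\,\sigma=\#\{i\in[m-1]:\sigma(i)>\sigma(i+1)\}$, $\mathsf{asc}\,\sigma=\#\{i\in[m-1]:\sigma(i)<\sigma(i+1)\}$. $(31\text{-}2)\sigma=\#\{(i,j):i+1<j\le m,\ \sigma(i+1)<\sigma(j)<\sigma(i)\}$, $(2\text{-}31)\sigma=\#\{(i,j):j<i<m,\ \sigma(i+1)<\sigma(j)<\sigma(i)\}$, $(2\text{-}13)\sigma=\#\{(i,j):j<i<m,\ \sigma(i)<\sigma(j)<\sigma(i+1)\}$, $(13\text{-}2)\sigma=\#\{(i,j):i+1<j\le m,\ \sigma(i)<\sigma(j)<\sigma(i+1)\}$. $\mathsf{cda}\,\sigma$ is the number of values $x$ with $\sigma^{-1}(x)<x<\sigma(x)$. $\mathsf{ldd}\,\sigma$ is the number of $i\in[m]$ with $\sigma(i-1)>\sigma(i)>\sigma(i+1)$ under the convention $\sigma(0)=0,\sigma(m+1)=\infty$; $\mathsf{rda}\,\sigma$ is the number of $i\in[m]$ with $\sigma(i-1)<\sigma(i)<\sigma(i+1)$ under the convention $\sigma(0)=\infty,\sigma(m+1)=0$. For $0\le k\le m$: $\widetilde{\mathfrak{S}}_{m,k}(321)=\{\sigma\in\mathfrak{S}_m(321):\mathsf{exc}\,\sigma=k,\mathsf{cda}\,\sigma=0\}$,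 $\widetilde{\mathfrak{S}}_{m,k}(213)=\{\sigma\in\mathfrak{S}_m(213):\mathsf{asc}\,\sigma=k,\mathsf{rda}\,\sigma=0\}$, $\widetilde{\mathfrak{S}}_{m,k}(312)=\{\sigma\in\mathfrak{S}_m(312):\mathsf{des}\,\sigma=k,\mathsf{ldd}\,\sigma=0\}$, $\widetilde{\mathfrak{S}}_{m,k}(132)=\{\sigma\in\mathfrak{S}_m(132):\mathsf{asc}\,\sigma=k,\mathsf{rda}\,\sigma=0\}$, $\widetilde{\mathfrak{S}}_{m,k}(231)=\{\sigma\in\mathfrak{S}_m(231):\mathsf{des}\,\sigma=k,\mathsf{ldd}\,\sigma=0\}$. *)

(* Defs.v *)
From mathcomp Require Import all_boot all_order all_algebra all_fingroup.
Set Implicit Arguments. Unset Strict Implicit. Unset Printing Implicit Defensive.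
Import GRing.Theory Num.Theory.

(* A permutation s : 'S_m of {0..m-1} is viewed as the permutation sigma of
   [m] = {1..m} given by sigma(i) = s(i-1) + 1.  Its one-line word: *)
Definition pword (m : nat) (s : 'S_m) : seq nat :=
  [seq (s i).+1 | i <- enum 'I_m].

Definition sg (m : nat) (s : 'S_m) (i : nat) : nat := nth 0 (pword s) i.-1.

Definition sginv (m : nat) (s : 'S_m) (x : nat) : nat := (index x (pword s)).+1.

Definition order_iso (u p : seq nat) : bool :=
  (size u == size p) &&
  [forall a : 'I_(size p), forall b : 'I_(size p),
     (nth 0 u a < nth 0 u b) == (nth 0 p a < nth 0 p b)].

Definition contains (m : nat) (s : 'S_m) (p : seq nat) : bool :=
  [exists mk : (size (pword s)).-tuple bool, order_iso (mask mk (pword s)) p].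

Definition avoids (m : nat) (s : 'S_m) (p : seq nat) : bool := ~~ contains s p.

Definition iv (m : nat) := iota 1 m.

Definition exc (m : nat) (s : 'S_m) : nat := count (fun i => i < sg s i) (iv m).
Definition fixp (m : nat) (s : 'S_m) : nat := count (fun i => sg s i == i) (iv m).
Definition inv (m : nat) (s : 'S_m) : nat :=
  \sum_(i <- iv m) count (fun j => (i < j) && (sg s j < sg s i)) (iv m).
Definition des (m : nat) (s : 'S_m) : nat :=
  count (fun i => sg s i.+1 < sg s i) (iv m.-1).
Definition asc (m : nat) (s : 'S_m) : nat :=
  count (fun i => sg s i < sg s i.+1) (iv m.-1).

Definition st31_2 (m : nat) (s : 'S_m) : nat :=
  \sum_(i <- iv m) count (fun j => (i.+1 < j) && (sg s i.+1 < sg s j < sg s i)) (iv m).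
Definition st2_31 (m : nat) (s : 'S_m) : nat :=
  \sum_(i <- iv m) count (fun j => (j < i < m) && (sg s i.+1 < sg s j < sg s i)) (iv m).
Definition st2_13 (m : nat) (s : 'S_m) : nat :=
  \sum_(i <- iv m) count (fun j => (j < i < m) && (sg s i < sg s j < sg s i.+1)) (iv m).
Definition st13_2 (m : nat) (s : 'S_m) : nat :=
  \sum_(i <- iv m) count (fun j => (i.+1 < j) && (sg s i < sg s j < sg s i.+1)) (iv m).

Definition cda (m : nat) (s : 'S_m) : nat :=
  count (fun x => sginv s x < x < sg s x) (iv m).

(* ldd with sigma(0) = 0, sigma(m+1) = infinity (encoded as m+1) *)
Definition sgL (m : nat) (s : 'S_m) (i : nat) : nat :=
  if i == 0 then 0 else if i == m.+1 then m.+1 else sg s i.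
Definition ldd (m : nat) (s : 'S_m) : nat :=
  count (fun i => sgL s i.+1 < sgL s i < sgL s i.-1) (iv m).

(* rda with sigma(0) = infinity (encoded as m+1), sigma(m+1) = 0 *)
Definition sgR (m : nat) (s : 'S_m) (i : nat) : nat :=
  if i == 0 then m.+1 else if i == m.+1 then 0 else sg s i.
Definition rda (m : nat) (s : 'S_m) : nat :=
  count (fun i => sgR s i.-1 < sgR s i < sgR s i.+1) (iv m).

Local Open Scope ring_scope.

Definition Npoly (R : comRingType) (n : nat) (t q r : R) : R :=
  \sum_(s : 'S_n | avoids s [:: 3; 2; 1]%N)
     t ^+ exc s * q ^+ inv s * r ^+ fixp s.

Definition gamma321 (R : unitRingType) (m k : nat) (q : R) : R :=
  \sum_(s : 'S_m | [&& avoids s [:: 3; 2; 1]%N, exc s == k & cda s == 0%N])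
     q ^ ((m%:Z + (inv s)%:Z - (exc s)%:Z)%R).
Definition gamma231 (R : comRingType) (m k : nat) (q : R) : R :=
  \sum_(s : 'S_m | [&& avoids s [:: 2; 3; 1]%N, des s == k & ldd s == 0%N])
     q ^+ (m + st31_2 s).
Definition gamma312 (R : comRingType) (m k : nat) (q : R) : R :=
  \sum_(s : 'S_m | [&& avoids s [:: 3; 1; 2]%N, des s == k & ldd s == 0%N])
     q ^+ (m + st2_31 s).
Definition gamma132 (R : comRingType) (m k : nat) (q : R) : R :=
  \sum_(s : 'S_m | [&& avoids s [:: 1; 3; 2]%N, asc s == k & rda s == 0%N])
     q ^+ (m + st2_13 s).
Definition gamma213 (R : comRingType) (m k : nat) (q : R) : R :=
  \sum_(s : 'S_m | [&& avoids s [:: 2; 1; 3]%N, asc s == k & rda s == 0%N])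
     q ^+ (m + st13_2 s).

(* Main.v *)
(* A 321-avoiding permutation is determined by its excedance positions and its
   excedance values, since it is increasing on excedances and on
   non-excedances.  Reading, for each i, whether i is an excedance position and
   whether i is an excedance value gives a two-coloured Motzkin path whose
   heights add up to the number of inversions.  The sums over 321-avoiding
   permutations therefore satisfy transfer recursions in (length, height), and
   comparing the recursion for N_n(t,q,t) with the one for the paths without
   double excedances (a shift by half a step of the associated Dyck paths)
   gives the gamma expansion.  On the other side, a 231-avoiding word without
   double descents is a B or x a A B with a minimal and A < x < B, and this
   first-return decomposition is that of Motzkin paths.  The remaining patterns
   follow by reversal and complementation. *)
Require Import Defs.
From mathcomp Require Import all_boot all_order all_algebra all_fingroup.
From mathcomp Require Import zify ring.
Set Implicit Arguments. Unset Strict Implicit. Unset Printing Implicit Defensive.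
Import GRing.Theory Num.Theory.

(** * One-line words, and statistics as sums over positions *)

Lemma sum_iv m (F : nat -> nat) : \sum_(i <- iv m) F i = \sum_(i < m) F i.+1.
Proof.
by rewrite /iv -[1]addn0 iotaDl big_map -[m in iota 0 m]subn0 big_mkord.
Qed.

Lemma count_iv m (P : pred nat) : count P (iv m) = \sum_(i < m) P i.+1.
Proof.
rewrite -(sum_iv m (fun i => nat_of_bool (P i))) -sum1_count big_mkcond /=.
by apply: eq_bigr => i _; case: (P i).
Qed.

Section OneLine.
Variables (m : nat) (s : 'S_m).

Lemma size_pword : size (pword s) = m.
Proof. by rewrite size_map size_enum_ord. Qed.

Lemma sgS (i : 'I_m) : sg s i.+1 = (s i).+1.
Proof. by rewrite /sg /= (nth_map i) ?size_enum_ord // nth_ord_enum. Qed.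

Lemma sginvS (i : 'I_m) : sginv s i.+1 = (s^-1%g i).+1.
Proof.
rewrite /sginv -{1}[i](permKV s) /pword (index_map (f := fun j => (s j).+1)).
  by rewrite index_enum_ord.
by move=> j k [] /val_inj /perm_inj.
Qed.

Lemma excE : exc s = \sum_(i < m) (i < s i).
Proof. by rewrite /exc count_iv; apply: eq_bigr => i _; rewrite sgS ltnS. Qed.

Lemma fixpE : fixp s = \sum_(i < m) (s i == i).
Proof. by rewrite /fixp count_iv; apply: eq_bigr => i _; rewrite sgS eqSS. Qed.

Lemma cdaE : cda s = \sum_(i < m) (s^-1%g i < i < s i).
Proof. by rewrite /cda count_iv; apply: eq_bigr => i _; rewrite sgS sginvS !ltnS. Qed.

Lemma invE : Defs.inv s = \sum_(i < m) \sum_(j < m) ((i < j) && (s j < s i)).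
Proof.
rewrite /Defs.inv sum_iv; apply: eq_bigr => i _; rewrite count_iv.
by apply: eq_bigr => j _; rewrite !sgS !ltnS.
Qed.

Lemma pword_perm : perm_eq (pword s) (iota 1 m).
Proof.
apply: uniq_perm; rewrite ?iota_uniq //.
  by rewrite map_inj_uniq ?enum_uniq // => j k [] /val_inj /perm_inj.
move=> x; rewrite mem_iota; apply/mapP/idP => [[i _ ->]|]; first by rewrite /= add1n ltnS.
case: x => // x; rewrite add1n /= ltnS => xm.
by exists (s^-1%g (Ordinal xm)); rewrite ?mem_enum // permKV.
Qed.

End OneLine.

Lemma pword_inj m : injective (@pword m).
Proof.
move=> s1 s2 e; apply/permP => i; apply/val_inj; apply: succn_inj.
by rewrite -!sgS /sg e.
Qed.

Lemma big_pword (T : Type) (idx : T) (op : Monoid.com_law idx) m (P : pred (seq nat)) (F : seq nat -> T) :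
  \big[op/idx]_(s : 'S_m | P (pword s)) F (pword s)
  = \big[op/idx]_(w <- permutations (iota 1 m) | P w) F w.
Proof.
rewrite -(big_map (@pword m) P F) /=; apply: perm_big.
have u1 : uniq [seq pword s | s <- index_enum ('S_m : finType)].
  by rewrite map_inj_uniq ?index_enum_uniq //; apply: pword_inj.
apply: uniq_perm; rewrite ?permutations_uniq //.
have sub : {subset [seq pword s | s <- index_enum ('S_m : finType)] <= permutations (iota 1 m)}.
  by move=> w /mapP[s _ ->]; rewrite mem_permutations pword_perm.
(* Injectivity gives one inclusion without repetition; both lists have size m!, so they have the
   same elements. *)
suff /(uniq_min_size u1 sub)[_ e] : size (permutations (iota 1 m)) <=
    size [seq pword s | s <- index_enum ('S_m : finType)] by [].
rewrite size_permutations ?iota_uniq // size_iota size_map.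
by rewrite -card_Sn -[index_enum _]enumT -cardE.
Qed.

Lemma subseq_consP (T : eqType) (x0 x : T) u w :
  reflect (exists2 i, i < size w & nth x0 w i = x /\ subseq u (drop i.+1 w)) (subseq (x :: u) w).
Proof.
elim: w => [|y w IH]; first by right => -[].
rewrite /=; have [->|ne] := eqVneq x y.
  apply: (iffP idP) => [h|[i _ [_ h]]]; first by exists 0; rewrite //= drop0.
  by apply: subseq_trans h _; apply: (drop_subseq w i).
apply: (iffP IH) => [[i lt_i [e h]]|[[|i] /= lt_i [e h]]]; first by exists i.+1.
  by rewrite e eqxx in ne.
by exists i.
Qed.

(** * Words of path steps *)

Section Rank.
Variable a : pred nat.

Definition rank i := count a (iota 0 i).
Definition corank i := count (predC a) (iota 0 i).

Lemma rankS i : rank i.+1 = rank i + a i.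
Proof. by rewrite /rank -addn1 iotaD count_cat /= addn0. Qed.

Lemma corankS i : corank i.+1 = corank i + ~~ a i.
Proof. by rewrite /corank -addn1 iotaD count_cat /= addn0. Qed.

Lemma rank_corank i : rank i + corank i = i.
Proof. by rewrite count_predC size_iota. Qed.

Lemma leq_rank i j : i <= j -> rank i <= rank j.
Proof. by move=> /subnK <-; rewrite addnC /rank iotaD count_cat leq_addr. Qed.

Lemma leq_corank i j : i <= j -> corank i <= corank j.
Proof. by move=> /subnK <-; rewrite addnC /corank iotaD count_cat leq_addr. Qed.

Lemma ltn_rank i j : a i -> i < j -> rank i < rank j.
Proof. by move=> ai /leq_rank; rewrite rankS ai addn1. Qed.

Lemma ltn_corank i j : ~~ a i -> i < j -> corank i < corank j.
Proof. by move=> ai /leq_corank; rewrite corankS ai addn1. Qed.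

(** Each block is increasing, so matching entries of equal index in two such lists defines a
    permutation increasing on each block. *)
Definition unshuffle n := filter a (iota 0 n) ++ filter (predC a) (iota 0 n).

Lemma unshuffle_perm n : perm_eq (unshuffle n) (iota 0 n).
Proof. by rewrite perm_filterC. Qed.

Lemma uniq_unshuffle n : uniq (unshuffle n).
Proof. by rewrite (perm_uniq (unshuffle_perm n)) iota_uniq. Qed.

Lemma size_unshuffle n : size (unshuffle n) = n.
Proof. by rewrite (perm_size (unshuffle_perm n)) size_iota. Qed.

Lemma mem_unshuffle n i : (i \in unshuffle n) = (i < n).
Proof. by rewrite (perm_mem (unshuffle_perm n)) mem_iota. Qed.

End Rank.

Lemma index_filter_iota (a : pred nat) n i : i < n -> a i ->
  index i (filter a (iota 0 n)) = rank a i.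
Proof.
move=> lt_in ai; rewrite -(subnKC lt_in) addSnnS iotaD filter_cat index_cat.
by rewrite mem_filter mem_iota ltnn !andbF /= ai /= eqxx addn0 size_filter.
Qed.

Lemma index_unshuffle (a : pred nat) n i : i < n ->
  index i (unshuffle a n) = if a i then rank a i else rank a n + corank a i.
Proof.
move=> lt_in; rewrite index_cat mem_filter mem_iota lt_in /= andbT.
case: ifP => ai; first by rewrite index_filter_iota.
by rewrite (@index_filter_iota (predC a)) //= ?ai // size_filter.
Qed.

(* Step i of the path: (is i an excedance position, is i an excedance value). *)
Definition letter := (bool * bool)%type.

Section Words.
Implicit Types (w : seq letter) (h : nat).

Definition opens w (i : nat) := (nth (false, false) w i).1.
Definition closes w (i : nat) := (nth (false, false) w i).2.

(* The truncated subtraction is a true one on Dyck words. *)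
Definition height w h i := h + rank (opens w) i - rank (closes w) i.

(** A closing letter needs positive height before the step, even if it also opens: the level colour
    [(true, true)] is thus forbidden at height 0. *)
Fixpoint dyck h w :=
  if w is x :: w' then (x.2 ==> (0 < h)) && dyck (h + x.1 - x.2) w' else h == 0.

Lemma rank_opens_cons x w i : rank (opens (x :: w)) i.+1 = x.1 + rank (opens w) i.
Proof.
by rewrite /rank (_ : iota 0 i.+1 = 0 :: map succn (iota 0 i)) /= ?count_map // -(iotaDl 1 0).
Qed.

Lemma rank_closes_cons x w i : rank (closes (x :: w)) i.+1 = x.2 + rank (closes w) i.
Proof.
by rewrite /rank (_ : iota 0 i.+1 = 0 :: map succn (iota 0 i)) /= ?count_map // -(iotaDl 1 0).
Qed.

(** Gives the inequalities between ranks by which positions and images are compared. The bound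
    ranges over all naturals because the default letter beyond the end does not close. *)
Lemma dyckP h w :
  reflect ((forall i, closes w i -> rank (closes w) i < h + rank (opens w) i)
           /\ h + rank (opens w) (size w) = rank (closes w) (size w))
          (dyck h w).
Proof.
elim: w h => [|x w IH] h.
  rewrite /= /rank /= addn0; apply: (iffP eqP) => [->|[_ //]].
  by split=> // -[].
rewrite /= rank_opens_cons rank_closes_cons.
apply: (iffP andP) => [[hx /IH[hw e]]|[hw e]].
- have h0 := implyP hx; have {}hx : x.2 <= h + x.1 by case: (x) hx => [? []] //=; lia.
  split; last by lia.
  case=> [|i]; first by rewrite /closes /rank /= addn0 => /h0.
  by rewrite rank_opens_cons rank_closes_cons => /hw; lia.
have hx : x.2 ==> (0 < h).
  by apply/implyP => x2; have := hw 0 x2; rewrite /rank /= addn0.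
split=> //; apply/IH; split.
  move=> i /(hw i.+1); rewrite rank_opens_cons rank_closes_cons.
  by case: (x) hx => [? []] /=; lia.
by case: (x) hx e => [? []] /=; lia.
Qed.

End Words.

(** * From paths to 321-avoiding permutations *)

Lemma order_iso3 x y z p q r :
  order_iso [:: x; y; z] [:: p; q; r]
  = [&& (x < y) == (p < q), (y < x) == (q < p), (x < z) == (p < r),
        (z < x) == (r < p), (y < z) == (q < r) & (z < y) == (r < q)].
Proof.
rewrite /order_iso eqxx /=; apply/forallP/and5P => [h|[h1 h2 h3 h4 /andP[h5 h6]]].
  have H a b : a < 3 -> b < 3 -> (nth 0 [:: x; y; z] a < nth 0 [:: x; y; z] b)
      == (nth 0 [:: p; q; r] a < nth 0 [:: p; q; r] b).
    by move=> la lb; have /forallP := h (Ordinal la) => /(_ (Ordinal lb)).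
  by split; [apply: (H 0 1)|apply: (H 1 0)|apply: (H 0 2)|apply: (H 2 0)
            |rewrite (H 1 2) ?(H 2 1)].
by case=> [[|[|[|a]]] la] //; apply/forallP; case=> [[|[|[|b]]] lb] //=; rewrite !ltnn.
Qed.

Lemma avoids3P m (s : 'S_m) (p q r : nat) :
  reflect (forall i j k : 'I_m, i < j -> j < k ->
             ~~ order_iso [:: (s i).+1; (s j).+1; (s k).+1] [:: p; q; r])
          (avoids s [:: p; q; r]).
Proof.
have nthE (i : 'I_m) : nth 0 (pword s) i = (s i).+1 by rewrite -sgS.
apply: (iffP idP) => [h i j k lij ljk|h].
  apply: contra h => iso; apply/existsP.
  have: subseq [:: (s i).+1; (s j).+1; (s k).+1] (pword s).
    apply/(subseq_consP 0); exists i; rewrite ?size_pword //; split=> //.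
    (* Each later position is counted inside the suffix that follows the previous letter. *)
    apply/(subseq_consP 0); exists (j - i.+1).
      by rewrite size_drop size_pword; have := ltn_ord j; lia.
    rewrite nth_drop subnKC // nthE drop_drop; split=> //.
    apply/(subseq_consP 0); exists (k - j.+1).
      by rewrite size_drop size_pword; have := ltn_ord k; lia.
    rewrite nth_drop (_ : _ + _ = k) ?nthE; last by lia.
    by rewrite sub0seq.
  case/subseqP => mk smk e; exists (Tuple (introT eqP smk)).
  by rewrite /= -e.
apply/negP => /existsP [mk]; move: (mask_subseq mk (pword s)).
case e: (mask mk (pword s)) => [|x [|y [|z [|? ?]]]] // sub; apply/negP; move: sub.
case/(subseq_consP 0) => i; rewrite size_pword => li [ei].
case/(subseq_consP 0) => j; rewrite size_drop size_pword => lj [ej].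
case/(subseq_consP 0) => k; rewrite !size_drop size_pword => lk [ek _].
rewrite !nth_drop in ej ek.
have lj' : i.+1 + j < m by lia.
have lk' : i.+1 + (j.+1 + k) < m by lia.
have := h (Ordinal li) (Ordinal lj') (Ordinal lk').
by rewrite -!nthE /= ei ej ek => -> //; lia.
Qed.

Lemma avoids321P m (s : 'S_m) :
  reflect (forall i j k : 'I_m, i < j -> j < k -> ~~ (s k < s j < s i))
          (avoids s [:: 3; 2; 1]).
Proof.
apply: (iffP (avoids3P _ _ _ _)) => h i j k lij ljk; have := h i j k lij ljk;
  rewrite order_iso3; lia.
Qed.

Section PathPerm.
Variables (n : nat) (w : n.-tuple letter).

Let SA := unshuffle (opens w) n.
Let SB := unshuffle (closes w) n.

Fact pathperm_subproof (i : 'I_n) : nth 0 SB (index (i : nat) SA) < n.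
Proof.
by rewrite -(mem_unshuffle (closes w)) mem_nth // size_unshuffle -[X in _ < X](size_unshuffle (opens w)) index_mem mem_unshuffle.
Qed.

(* The k-th excedance position is sent to the k-th excedance value, and the
   k-th non-excedance position to the k-th non-excedance value. *)
Definition pathperm_fun (i : 'I_n) : 'I_n := Ordinal (pathperm_subproof i).

Lemma pathperm_inj : injective pathperm_fun.
Proof.
have lt_index (k : 'I_n) : index (k : nat) SA < n.
  by rewrite -[X in _ < X](size_unshuffle (opens w)) index_mem mem_unshuffle.
move=> i j [] /eqP; rewrite nth_uniq ?size_unshuffle ?uniq_unshuffle // => /eqP e.
by apply/val_inj; apply: (@index_inj _ 0 SA) e; rewrite mem_unshuffle.
Qed.

Definition pathperm : 'S_n := perm pathperm_inj.

Lemma index_pathperm i : index (pathperm i : nat) SB = index (i : nat) SA.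
Proof.
rewrite permE /= index_uniq ?uniq_unshuffle // size_unshuffle.
by rewrite -[X in _ < X](size_unshuffle (opens w)) index_mem mem_unshuffle.
Qed.

Section Dyck.
Hypothesis dw : dyck 0 w.
Local Notation s := pathperm.
Local Notation a := (opens w).
Local Notation b := (closes w).

Let dyck_lt i : b i -> rank b i < rank a i.
Proof. by case/dyckP: dw => h _ /h. Qed.

Let dyck_end : rank a n = rank b n.
Proof. by case/dyckP: dw; rewrite size_tuple. Qed.

Let dyck_le i : rank b i <= rank a i.
Proof.
elim: i => // i IH; rewrite !rankS; case: (boolP (b i)) => [/dyck_lt|_]; lia.
Qed.

(** As many steps open as close, so the first blocks of the two unshuffled lists have equal length,
    and equal indices lie in corresponding blocks. *)
Lemma closes_pathperm (i : 'I_n) : b (s i) = a i.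
Proof.
have := index_pathperm i; rewrite !index_unshuffle // dyck_end.
case: (boolP (a i)) => ai; case: (boolP (b (s i))) => bi //.
- by have := ltn_rank ai (ltn_ord i); lia.
- by have := ltn_rank bi (ltn_ord (s i)); lia.
Qed.

Lemma rank_pathperm (i : 'I_n) : a i -> rank b (s i) = rank a i.
Proof.
by have := index_pathperm i; rewrite !index_unshuffle // closes_pathperm => + ai; rewrite ai.
Qed.

Lemma corank_pathperm (i : 'I_n) : ~~ a i -> corank b (s i) = corank a i.
Proof.
have := index_pathperm i; rewrite !index_unshuffle // closes_pathperm dyck_end.
by move=> + /negbTE ai; rewrite ai => /addnI.
Qed.

(** If [i] opens and [s i <= i], then [rank a (s i) <= rank a i = rank b (s i)], against the Dyck
    condition at the closing step [s i]. If [i] does not open and [i < s i], then [corank a i <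
    corank a (s i) <= corank b (s i) = corank a i]. *)
Lemma exc_pathperm (i : 'I_n) : (i < s i) = a i.
Proof.
have := closes_pathperm i; have := rank_corank a i; have := rank_corank b (s i).
case: (boolP (a i)) => ai.
  have := dyck_lt (i := s i); have := rank_pathperm ai => e h _ _ bi.
  rewrite ltnNge; apply/negP => /(leq_rank a); have := h bi; lia.
have := corank_pathperm ai => e _ _ /negbT nbi; apply/negbTE; rewrite -leqNgt.
rewrite leqNgt; apply/negP => /(ltn_corank ai).
have := dyck_le (s i); have := rank_corank b (s i); have := rank_corank a (s i); lia.
Qed.

Lemma excV_pathperm (v : 'I_n) : (s^-1%g v < v) = b v.
Proof. by rewrite -{2 3}[v](permKV s) exc_pathperm closes_pathperm. Qed.

Lemma pathperm_mono (i j : 'I_n) : a i = a j -> i < j -> s i < s j.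
Proof.
case: (boolP (a i)) => ai /esym aj lij.
  have := ltn_rank ai lij; rewrite -!rank_pathperm // ltnNge => h.
  by rewrite ltnNge; apply: contra h; apply: leq_rank.
have := ltn_corank ai lij; rewrite -!corank_pathperm ?aj // ltnNge => h.
by rewrite ltnNge; apply: contra h; apply: leq_corank.
Qed.

Lemma pathperm_avoids : avoids s [:: 3; 2; 1].
Proof.
apply/avoids321P => i j k lij ljk; apply/negP => /andP[lkj lji].
(* Among three positions two agree on being openings, and [s] is increasing on those two. *)
have := @pathperm_mono i j; have := @pathperm_mono i k; have := @pathperm_mono j k.
case: (a i) (a j) (a k) => [] [] []; lia.
Qed.

(** For a non-opening [i], the value [s i] is the non-closing index with
    [corank b (s i) = corank a i]; at a non-closing [i] this index is [i] itself exactly when the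
    two ranks agree. *)
Lemma fix_pathperm (i : 'I_n) : (s i == i) = ~~ (a i || b i) && (rank a i == rank b i).
Proof.
have ei := exc_pathperm i; have bi := closes_pathperm i.
case: (boolP (a i)) ei => ai ei /=.
  by apply/negbTE; apply: contraTneq ei => ->; rewrite ltnn.
apply/eqP/andP => [e|[nbi /eqP r]].
  rewrite e in bi; rewrite bi ai; split=> //; apply/eqP.
  have := corank_pathperm ai; rewrite e.
  by have := rank_corank a i; have := rank_corank b i; lia.
apply/val_inj; have := corank_pathperm ai.
have := rank_corank a i; have := rank_corank b i; rewrite -r => e1 e2 e3.
have e4 : corank b (s i) = corank b i by lia.
case: (ltngtP (s i) i) => // l.
  by have := ltn_corank (_ : ~~ b (s i)) l; rewrite bi ai e4 ltnn => /(_ isT).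
by have := ltn_corank nbi l; rewrite e4 ltnn.
Qed.

End Dyck.
End PathPerm.

Section PermPath.
Variables (n : nat) (s : 'S_n).

Definition permpath : n.-tuple letter := [tuple (i < s i, s^-1%g i < i) | i < n].

Lemma opens_permpath (i : 'I_n) : opens permpath i = (i < s i).
Proof. by rewrite /opens -tnth_nth tnth_mktuple. Qed.

Lemma closes_permpath (i : 'I_n) : closes permpath i = (s^-1%g i < i).
Proof. by rewrite /closes -tnth_nth tnth_mktuple. Qed.

End PermPath.

(** * From 321-avoiding permutations to paths *)

(** Writing numbers as sums of indicators lets the counting arguments below be checked term by
    term. *)
Lemma sum_ord_lt n v : v <= n -> \sum_(i < n) (i < v) = v.
Proof.
move=> le_vn; transitivity (\sum_(i < n | i < v) 1).
  by rewrite [RHS]big_mkcond /=; apply: eq_bigr => i _; case: ifP.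
by rewrite -(big_ord_widen n (fun=> 1)) // sum1_card card_ord.
Qed.

Lemma rank_sum (a : pred nat) n i : i <= n -> rank a i = \sum_(j < n) ((j < i) && a j).
Proof.
move=> le_in; transitivity (\sum_(j < n | j < i) (a j : nat)); last first.
  by rewrite big_mkcond /=; apply: eq_bigr => j _; case: ifP.
rewrite -(big_ord_widen n (fun j => a j : nat)) // /rank -sum1_count big_mkcond /=.
by rewrite -[i in iota 0 i]subn0 big_mkord; apply: eq_bigr => j _; case: (a j).
Qed.

Lemma sum_pred1_ord n (j : 'I_n) : \sum_(i < n) (i == j) = 1.
Proof. by rewrite (bigD1 j) //= eqxx big1 // => i /negbTE ->. Qed.

Section PermPathTheory.
Variables (n : nat) (s : 'S_n).

Lemma sum_perm_lt v : v <= n -> \sum_(i < n) (s i < v) = v.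
Proof.
by move=> le_vn; rewrite -[RHS](sum_ord_lt le_vn) [RHS](reindex_inj (@perm_inj _ s)).
Qed.

Lemma rank_opens_permpath i : i <= n ->
  rank (opens (permpath s)) i = \sum_(j < n) ((j < i) && (j < s j)).
Proof.
move=> le_in; rewrite (rank_sum _ le_in).
by apply: eq_bigr => j _; rewrite opens_permpath.
Qed.

Lemma rank_closes_permpath i : i <= n ->
  rank (closes (permpath s)) i = \sum_(j < n) ((s j < i) && (j < s j)).
Proof.
move=> le_in; rewrite (rank_sum _ le_in) (reindex_inj (@perm_inj _ s)) /=.
by apply: eq_bigr => j _; rewrite closes_permpath permK.
Qed.

(** An excedance position before [i] has its value either below [i] or at least [i]; in the second
    case its arc spans [i] and adds to the height. *)
Lemma rank_permpath i : i <= n ->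
  rank (opens (permpath s)) i
  = rank (closes (permpath s)) i + \sum_(j < n) (j < i <= s j).
Proof.
move=> le_in; rewrite rank_opens_permpath // rank_closes_permpath // -big_split.
apply: eq_bigr => j _ /=; lia.
Qed.

Lemma height_permpath i : i <= n -> height (permpath s) 0 i = \sum_(j < n) (j < i <= s j).
Proof. by move=> le_in; rewrite /height add0n (rank_permpath le_in) addKn. Qed.

Lemma dyck_permpath : dyck 0 (permpath s).
Proof.
apply/dyckP; rewrite size_tuple; split; last first.
  rewrite add0n rank_permpath // big1 ?addn0 // => j _.
  by rewrite [n <= _]leqNgt (ltn_ord (s j)) andbF.
move=> i; have [lt_in|le_ni] := ltnP i n; last by rewrite /closes nth_default ?size_tuple.
move=> ci; have {ci} : s^-1%g (Ordinal lt_in) < i by rewrite -[i]/(val (Ordinal lt_in)) -closes_permpath.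
move: (ltnW lt_in) => le_in hi; rewrite add0n rank_permpath // -addn1 leq_add2l.
(* The arc ending at [i] still spans [i], so the height there is positive. *)
by rewrite (bigD1 (s^-1%g (Ordinal lt_in))) //= permKV /= leqnn hi.
Qed.

Hypothesis av : avoids s [:: 3; 2; 1].
Let noinv3 := elimT (avoids321P s) av.

(** Suppose [s j < s i]. Avoidance forces every value below [s j] to sit before [j], and position
    [i] lies before [j] as well, so [s j + 1 <= j], against [j < s j]. *)
Lemma avoids321_exc_mono (i j : 'I_n) : i < j -> i < s i -> j < s j -> s i < s j.
Proof.
move=> lij ei ej; rewrite ltnNge leq_eqVlt; apply/negP => /orP[/eqP/val_inj/perm_inj e|l].
  by rewrite e ltnn in lij.
suff: \sum_(k < n) ((s k < s j) + (k == i)) <= \sum_(k < n) (k < j).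
  rewrite big_split /= sum_perm_lt ?(ltnW (ltn_ord _)) // sum_pred1_ord.
  by rewrite sum_ord_lt ?(ltnW (ltn_ord _)) //; lia.
apply: leq_sum => k _; have [->|ne] := eqVneq k i; first by rewrite lij ltnNge (ltnW l).
rewrite addn0; case: (ltngtP k j) => [_|ljk|/val_inj ->]; rewrite ?ltnn ?leq_b1 //.
by have := noinv3 lij ljk; rewrite l andbT => /negbTE ->.
Qed.

(** Suppose [s j < s i]. Avoidance forces all positions up to [i] to have values at most [s i], and
    so does [j]; hence [i + 2 <= s i + 1], against [s i <= i]. *)
Lemma avoids321_nonexc_mono (i j : 'I_n) : i < j -> s i <= i -> s j <= j -> s i < s j.
Proof.
move=> lij ei ej; rewrite ltnNge leq_eqVlt; apply/negP => /orP[/eqP/val_inj/perm_inj e|l].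
  by rewrite e ltnn in lij.
suff: \sum_(k < n) ((k < i.+1) + (k == j)) <= \sum_(k < n) (s k < (s i).+1).
  rewrite big_split /= sum_perm_lt ?ltn_ord // sum_pred1_ord.
  by rewrite sum_ord_lt ?ltn_ord //; lia.
apply: leq_sum => k _; have [->|ne] := eqVneq k j; first by lia.
rewrite addn0 !ltnS; case: (ltngtP k i) => [lki|_|/val_inj ->]; rewrite ?leqnn //.
by have := noinv3 lki lij; lia.
Qed.

(** By monotonicity, the excedance positions before [i] are those whose values lie below [s i] when
    [i] is an excedance, and likewise for non-excedances. Hence [s] matches equal ranks, as
    [pathperm] does. *)
Lemma permpathK : pathperm (permpath s) = s.
Proof.
apply/permP => i; apply: ord_inj.
apply: (@index_inj _ 0 (unshuffle (closes (permpath s)) n)); rewrite ?mem_unshuffle //.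
rewrite /= index_pathperm !index_unshuffle // opens_permpath closes_permpath permK.
have e : rank (opens (permpath s)) n = rank (closes (permpath s)) n.
  by have /dyckP[_] := dyck_permpath; rewrite size_tuple.
have [ei|ei] := boolP (i < s i).
  rewrite rank_opens_permpath ?(ltnW (ltn_ord _)) // rank_closes_permpath ?(ltnW (ltn_ord _)) //.
  apply: eq_bigr => j _; case: (boolP (j < s j)) => ej; rewrite ?andbF // !andbT.
  case: (ltngtP j i) => [l|l|/val_inj ->]; last by rewrite ltnn.
    by rewrite avoids321_exc_mono.
  by rewrite ltnNge ltnW // avoids321_exc_mono.
rewrite e; congr (_ + _).
rewrite -leqNgt in ei.
have corankE (a : pred nat) k : k <= n -> corank a k = \sum_(j < n) ((j < k) && ~~ a j).
  by move=> le_kn; rewrite -(rank_sum (predC a) le_kn).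
rewrite !corankE ?(ltnW (ltn_ord _)) // [RHS](reindex_inj (@perm_inj _ s)) /=.
apply: eq_bigr => j _; rewrite opens_permpath closes_permpath permK.
case: (ltnP j (s j)) => ej; rewrite ?andbF // !andbT.
case: (ltngtP j i) => [l|l|/val_inj ->]; last by rewrite ltnn.
  by rewrite avoids321_nonexc_mono.
by rewrite ltnNge ltnW // avoids321_nonexc_mono.
Qed.

(** A non-excedance starts no inversion. At an excedance [i] all earlier values are smaller, so [i]
    starts [s i - i] inversions, the number of [v] spanned by its arc. *)
Lemma inv_permpath : Defs.inv s = \sum_(v < n) height (permpath s) 0 v.
Proof.
rewrite invE; transitivity (\sum_(v < n) \sum_(i < n) (i < v <= s i)); last first.
  by apply: eq_bigr => v _; rewrite height_permpath // ltnW.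
rewrite [RHS]exchange_big /=; apply: eq_bigr => i _.
have [le_si|ei] := leqP (s i) i.
  rewrite !big1 // => j _; first by lia.
  case: (ltnP i j) => // lij /=.
  have [lj|ej] := leqP (s j) j; last by lia.
  by rewrite ltnNge ltnW // avoids321_nonexc_mono.
(* Adding [i + 1] makes both sides equal to [s i + 1] and avoids subtraction. *)
apply: (@addnI (\sum_(j < n) (j < i.+1))).
rewrite -[RHS]big_split /= sum_ord_lt ?ltn_ord //.
transitivity (\sum_(v < n) (v < (s i).+1)); last by apply: eq_bigr => v _; lia.
rewrite sum_ord_lt ?ltn_ord // addSn -[in RHS](@sum_perm_lt (s i)) ?(ltnW (ltn_ord _)) //.
congr (_.+1); rewrite -[X in X + _](@sum_ord_lt n i) ?(ltnW (ltn_ord _)) // -big_split /=.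
apply: eq_bigr => j _; case: (ltngtP j i) => [l|l|/val_inj ->]; rewrite ?ltnn //=.
have [lj|ej] := leqP (s j) j; first by lia.
by rewrite avoids321_exc_mono.
Qed.

End PermPathTheory.

Section PathPermTheory.
Variables (n : nat) (w : n.-tuple letter).
Hypothesis dw : dyck 0 w.

Lemma pathpermK : permpath (pathperm w) = w.
Proof.
apply: eq_from_tnth => i; rewrite tnth_mktuple exc_pathperm // excV_pathperm //.
by rewrite (tnth_nth (false, false)) /opens /closes; case: (nth _ _ _).
Qed.

Lemma exc_pathpermE : exc (pathperm w) = \sum_(i < n) opens w i.
Proof. by rewrite excE; apply: eq_bigr => i _; rewrite exc_pathperm. Qed.

Lemma cda_pathpermE : cda (pathperm w) = \sum_(i < n) (opens w i && closes w i).
Proof.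
by rewrite cdaE; apply: eq_bigr => i _; rewrite exc_pathperm // excV_pathperm // andbC.
Qed.

Lemma inv_pathpermE : Defs.inv (pathperm w) = \sum_(i < n) height w 0 i.
Proof. by rewrite inv_permpath ?pathpermK // pathperm_avoids. Qed.

Lemma rank_closes_le i : rank (closes w) i <= rank (opens w) i.
Proof.
case/dyckP: dw => h _; elim: i => // i IH; rewrite !rankS.
by case: (boolP (closes w i)) => [/h|_]; lia.
Qed.

Lemma fixp_pathpermE :
  fixp (pathperm w) = \sum_(i < n) (~~ (opens w i || closes w i) && (height w 0 i == 0)).
Proof.
rewrite fixpE; apply: eq_bigr => i _; rewrite fix_pathperm // /height add0n.
by rewrite subn_eq0 eqn_leq rank_closes_le andbT.
Qed.

End PathPermTheory.

Lemma big_avoids321 (T : Type) (idx : T) (op : Monoid.com_law idx) n (P : pred 'S_n) (F : 'S_n -> T) :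
  \big[op/idx]_(s : 'S_n | avoids s [:: 3; 2; 1] && P s) F s
  = \big[op/idx]_(w : n.-tuple letter | dyck 0 w && P (pathperm w)) F (pathperm w).
Proof.
rewrite (reindex_onto (@pathperm n) (@permpath n)) /=; last first.
  by move=> s /andP[av _]; rewrite permpathK.
apply: eq_bigl => w; apply/andP/andP => [[/andP[_ ->] /eqP <-]|[dw ->]].
  by rewrite dyck_permpath.
by rewrite pathperm_avoids // pathpermK.
Qed.

(** * Transfer recursions *)

Lemma height_cons (x : letter) w h i : x.2 <= h + x.1 ->
  height (x :: w) h i.+1 = height w (h + x.1 - x.2) i.
Proof. by rewrite /height rank_opens_cons rank_closes_cons; lia. Qed.

Lemma sum_opens n (w : n.-tuple letter) : \sum_(i < n) opens w i = rank (opens w) n.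
Proof. by rewrite (rank_sum _ (leqnn n)); apply: eq_bigr => i _; rewrite ltn_ord. Qed.

Lemma sum_closes n (w : n.-tuple letter) : \sum_(i < n) closes w i = rank (closes w) n.
Proof. by rewrite (rank_sum _ (leqnn n)); apply: eq_bigr => i _; rewrite ltn_ord. Qed.

Local Open Scope ring_scope.

Section PathSums.
Variables (R : comNzRingType) (om : nat -> letter -> R).

Fixpoint pathsum (n h : nat) : R :=
  if n is n'.+1 then
    \sum_(x : letter | x.2 ==> (0 < h)%N) om h x * pathsum n' (h + x.1 - x.2)%N
  else (h == 0)%N%:R.

Lemma pathsumE n h :
  \sum_(w : n.-tuple letter | dyck h w)
     \prod_(i < n) om (height w h i) (opens w i, closes w i) = pathsum n h.
Proof.
elim: n h => [|n IH] h.
  case: h => [|h] /=; last by rewrite big_pred0 // => w; rewrite tuple0.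
  rewrite (big_pred1 [tuple]) ?big_ord0 // => w.
  by transitivity true; [rewrite (tuple0 w)|apply/esym/eqP; apply: tuple0].
rewrite (reindex (fun p : letter * n.-tuple letter => [tuple of p.1 :: p.2])); last first.
  exists (fun t => (thead t, [tuple of behead t])) => [[x w] _|t _] /=.
    by congr (_, _); apply/val_inj.
  by rewrite [t in RHS]tuple_eta.
rewrite /= (eq_bigl (fun p : letter * n.-tuple letter =>
   (p.1.2 ==> (0 < h)%N) && dyck (h + p.1.1 - p.1.2)%N p.2)) //.
rewrite -(pair_big_dep (fun x : letter => x.2 ==> (0 < h)%N)
   (fun x (w : n.-tuple letter) => dyck (h + x.1 - x.2)%N w)
   (fun x w => \prod_(i < n.+1) om (height (x :: w) h i) (opens (x :: w) i, closes (x :: w) i))) /=.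
apply: eq_bigr => x hx; rewrite -IH big_distrr /=; apply: eq_bigr => w dw.
rewrite big_ord_recl /=; congr (_ * _).
  by rewrite /height /rank /= addn0 subn0 /opens /closes /=; case: (x).
apply: eq_bigr => i _; rewrite /bump leq0n add1n height_cons //.
by case: (x) hx => [? []] //=; lia.
Qed.

Lemma pathsumS n h : pathsum n.+1 h =
  om h (true, false) * pathsum n h.+1 + om h (false, false) * pathsum n h
  + (if h is h'.+1 then om h (true, true) * pathsum n h + om h (false, true) * pathsum n h' else 0).
Proof.
transitivity (\sum_(a : bool) \sum_(b : bool) if b ==> (0 < h)%N then
    om h (a, b) * pathsum n (h + a - b)%N else 0).
  by rewrite pair_bigA /= big_mkcond; apply: eq_bigr => -[a b] _.
rewrite !big_bool /=.
case: h => [|h] /=; first by rewrite !addn1 !addn0 !subn0; ring.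
by rewrite !addn1 !addn0 !subn0 !subn1 /=; ring.
Qed.

End PathSums.

(* u marks excedances, q inversions, r fixed points, z double excedances and c
   the steps that are neither excedance positions nor excedance values. *)
Definition weight321 (R : comNzRingType) (u q r z c : R) (h : nat) (x : letter) : R :=
  u ^+ x.1 * q ^+ h * r ^+ (~~ (x.1 || x.2) && (h == 0)%N) * z ^+ (x.1 && x.2)
  * c ^+ (~~ (x.1 || x.2)).

(** The exponent of [c] counts the steps that neither open nor close: inclusion-exclusion, with as
    many closings as openings. The identity [e2] shows that the subtraction is exact. *)
Lemma sum_avoids321 (R : comNzRingType) n (u q r z c : R) :
  \sum_(s : 'S_n | avoids s [:: 3; 2; 1]%N)
     u ^+ exc s * q ^+ Defs.inv s * r ^+ fixp s * z ^+ cda s * c ^+ (n + cda s - (exc s).*2)%N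
  = pathsum (weight321 u q r z c) n 0.
Proof.
rewrite -pathsumE; under eq_bigl do rewrite -[avoids _ _]andbT.
rewrite (big_avoids321 _ xpredT) /=; under eq_bigl do rewrite andbT.
apply: eq_bigr => w dw; rewrite /weight321 /= !big_split /=.
rewrite exc_pathpermE // inv_pathpermE // cda_pathpermE // fixp_pathpermE //.
rewrite !prodrXr; congr (_ * _ ^+ _).
apply: (@addIn ((\sum_(i < n) opens w i).*2)).
have e : (\sum_(i < n) opens w i = \sum_(i < n) closes w i)%N.
  by rewrite sum_opens sum_closes; have /dyckP[_] := dw; rewrite size_tuple.
have e2 : (\sum_(i < n) ~~ (opens w i || closes w i) + (\sum_(i < n) opens w i).*2
   = n + \sum_(i < n) (opens w i && closes w i))%N.
  have n1 : (n = \sum_(i < n) 1)%N by rewrite sum1_card card_ord.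
  rewrite -addnn [X in (_ + (_ + X))%N]e -!big_split /= [X in _ = (X + _)%N]n1 -big_split /=.
  by apply: eq_bigr => i _; case: (opens w i) (closes w i) => [] [].
by rewrite e2 subnK // -e2 leq_addl.
Qed.

(* In terms of Dyck paths, cut after the first half of a step: the height is then
   a mixture of the heights h and h.+1 at whole steps. *)
Lemma pathsum_shift (F : fieldType) (t q : F) n h : q != 0 ->
  q ^+ n * pathsum (weight321 (t / q) q 1 0 (1 + t / q)) n h
  = q ^+ h * (pathsum (weight321 t q t 1 1) n h + pathsum (weight321 t q t 1 1) n h.+1).
Proof.
move=> q0; elim: n h => [|n IH] h; first by case: h => [|h] /=; ring.
rewrite !pathsumS; case: h => [|h].
  have e := IH 0%N; have e1 := IH 1%N; move: e e1.
  set z := pathsum _; set w := pathsum _ => e e1.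
  rewrite /weight321 /= exprS !expr1n !expr0 !expr1 !mulr1 !mul1r.
  (* The extra factor [q] turns [1 + t / q] into [q + t] and leaves [q ^+ n] for the induction
     hypotheses. *)
  transitivity (t * (q ^+ n * z n 1%N) + (q + t) * (q ^+ n * z n 0%N)).
    by field.
  by rewrite e e1; ring.
have e := IH h; have e1 := IH h.+1; have e2 := IH h.+2; move: e e1 e2.
set z := pathsum _; set w := pathsum _ => e e1 e2.
rewrite /weight321 /= [q ^+ n.+1]exprS !expr1n !expr0 !expr1 !mulr1 ?mul1r.
transitivity (q ^+ h.+1 * (t * (q ^+ n * z n h.+2) + (q + t) * (q ^+ n * z n h.+1)
  + q * (q ^+ n * z n h))).
  by field.
by rewrite e e1 e2 !exprS; ring.
Qed.

(** With r = t, both first steps possible at height 0, an opening and a fixed point, weigh t. The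
    sum over heights 0 and 1 that they leave is the right side of [pathsum_shift] at height 0. *)
Lemma pathsum_first (F : fieldType) (t q : F) n : q != 0 ->
  pathsum (weight321 t q t 1 1) n.+1 0
  = t * (q ^+ n * pathsum (weight321 (t / q) q 1 0 (1 + t / q)) n 0).
Proof.
move=> q0; rewrite pathsum_shift // pathsumS /weight321 /=.
by rewrite !expr1n !expr0 !expr1; ring.
Qed.

(** * 231-avoiding words without double descents *)

Local Open Scope nat_scope.

Section Words231.
Implicit Types (w A B : seq nat) (x p a : nat).

Definition no231_at x : rel nat := fun y z => ~~ (z < x < y).

Fixpoint av231 w := if w is x :: w' then pairwise (no231_at x) w' && av231 w' else true.

(* In the next three functions p is the letter preceding w (0 if there is none,
   which creates no descent), and b tells whether p was reached by a descent. *)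
Fixpoint no_ddes (b : bool) p w :=
  if w is y :: w' then ~~ (b && (y < p)) && no_ddes (y < p) y w' else true.

Fixpoint ndes p w := if w is y :: w' then (y < p) + ndes y w' else 0.

Fixpoint drop_sum p w := if w is y :: w' then (p - y) + drop_sum y w' else 0.

(** The junction is an ascent, so [B] is scanned as if it began a word; the next two lemmas rest on
    the same fact. *)
Lemma no_ddes_cat b p A B : allrel ltn (p :: A) B ->
  no_ddes b p (A ++ B) = no_ddes b p A && no_ddes false 0 B.
Proof.
elim: A b p => [|x A IH] b p /=.
  case: B => //= y B; rewrite allrel_consl => /andP[/andP[/ltnW]] /=.
  by rewrite leqNgt => /negbTE-> _ _; rewrite andbF.
by rewrite allrel_consl => /andP[_ /IH->]; rewrite andbA.
Qed.

Lemma ndes_cat p A B : allrel ltn (p :: A) B -> ndes p (A ++ B) = ndes p A + ndes 0 B.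
Proof.
elim: A p => [|x A IH] p /=.
  case: B => //= y B; rewrite allrel_consl => /andP[/andP[/ltnW]] /=.
  by rewrite leqNgt => /negbTE->.
by rewrite allrel_consl => /andP[_ /IH->]; rewrite addnA.
Qed.

Lemma drop_sum_cat p A B : allrel ltn (p :: A) B ->
  drop_sum p (A ++ B) = drop_sum p A + drop_sum 0 B.
Proof.
elim: A p => [|x A IH] p /=.
  by case: B => //= y B; rewrite allrel_consl => /andP[/andP[/ltnW]] /=; rewrite -subn_eq0 => /eqP->.
by rewrite allrel_consl => /andP[_ /IH->]; rewrite addnA.
Qed.

Lemma no231_at_cat x A B : all (fun y => y <= x) A -> all (fun z => x <= z) B ->
  pairwise (no231_at x) (A ++ B).
Proof.
move=> /allP hA /allP hB; rewrite pairwise_cat; apply/and3P; split.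
- by apply/allrelP => y z /hA yx _; rewrite /no231_at [x < y]ltnNge yx andbF.
- apply/(pairwiseP 0) => i j; rewrite !inE => li _ _; rewrite /no231_at.
  by have /hA := mem_nth 0 li; rewrite leqNgt => /negbTE->; rewrite andbF.
apply/(pairwiseP 0) => i j; rewrite !inE => _ lj _; rewrite /no231_at.
by have /hB := mem_nth 0 lj; rewrite leqNgt => /negbTE->.
Qed.

Lemma av231_cat A B : allrel ltn A B -> av231 (A ++ B) = av231 A && av231 B.
Proof.
elim: A => //= x A IH; rewrite allrel_consl => /andP[xB AB]; rewrite IH // andbA; congr (_ && _).
have {}xB : all (fun z => x <= z) B by apply: sub_all xB => z /ltnW.
rewrite pairwise_cat; suff [-> ->] : pairwise (no231_at x) B /\ allrel (no231_at x) A B.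
  by rewrite andbT.
split; first exact: (@no231_at_cat x [::] B).
apply/allrelP => y z _ /(allP xB); rewrite /no231_at leqNgt => /negbTE->.
by [].
Qed.

(** Once a letter above [x] has occurred, a later letter below [x] would complete a 231 begun by
    [x]. *)
Lemma no231_at_split x w : x \notin w -> pairwise (no231_at x) w ->
  w = [seq y <- w | y < x] ++ [seq y <- w | x < y].
Proof.
elim: w => //= y w IH; rewrite inE negb_or => /andP[ne xw] /andP[hy /(IH xw)].
case: (ltngtP y x) ne => // lt _ e /=; first by congr (_ :: _).
have all_gt : all (fun z => x < z) w.
  apply/allP => z zw; have := allP hy z zw; rewrite /no231_at lt andbT -leqNgt leq_eqVlt.
  by case/orP => // /eqP exz; rewrite exz zw in xw.
rewrite (all_filterP all_gt) (eq_in_filter (a2 := pred0)) ?filter_pred0 // => z /(allP all_gt).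
by move=> /ltnW; rewrite leqNgt => /negbTE.
Qed.

Definition good231 w := av231 w && no_ddes false 0 w.

(** The start [a] varies because the factors of a word occupy later intervals. *)
Definition words231 a m := [seq w <- permutations (iota a m) | good231 w].

Lemma mem_words231 a m w : (w \in words231 a m) = good231 w && perm_eq w (iota a m).
Proof. by rewrite mem_filter mem_permutations. Qed.

Lemma words231_bounds a m w x : w \in words231 a m -> (x \in w) = (a <= x < a + m).
Proof. by rewrite mem_words231 => /andP[_ /perm_mem->]; rewrite mem_iota. Qed.

Lemma size_words231 a m w : w \in words231 a m -> size w = m.
Proof. by rewrite mem_words231 => /andP[_ /perm_size->]; rewrite size_iota. Qed.

Lemma allrel_words231 a i j b A B x : A \in words231 a i -> B \in words231 b j ->
  a + i <= b -> x < b -> allrel ltn (x :: A) B.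
Proof.
move=> wA wB ab xb; apply/allrelP => y z; rewrite inE (words231_bounds _ wA).
by rewrite (words231_bounds _ wB) => /orP[/eqP->|]; lia.
Qed.

Lemma good231_cons a B : all (fun z => a < z) B -> good231 (a :: B) = good231 B.
Proof.
move=> aB; rewrite /good231 /= (@no231_at_cat a [::]) //=; last by apply: sub_all aB => z /ltnW.
congr (_ && _); rewrite -[B]cat0s no_ddes_cat //=.
by rewrite allrel_consl aB; apply/allrelP.
Qed.

Lemma good231_cons2 x a A B : a < x -> all (fun y => a < y < x) A -> all (fun z => x < z) B ->
  good231 [:: x, a & A ++ B] = good231 A && good231 B.
Proof.
move=> ax hA hB.
have AB p : p \in x :: a :: A -> p <= x.
  by rewrite !inE => /or3P[/eqP->|/eqP->|/(allP hA)/andP[_ /ltnW]] //; apply: ltnW.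
have allAB C : {subset C <= x :: a :: A} -> allrel ltn C B.
  by move=> sC; apply/allrelP => y z /sC/AB yx /(allP hB); apply: leq_ltn_trans.
rewrite /good231 /= ax /=.
have -> : pairwise (no231_at x) (A ++ B).
  apply: no231_at_cat; first by apply: sub_all hA => y /andP[_ /ltnW].
  by apply: sub_all hB => y /ltnW.
have -> : pairwise (no231_at a) (A ++ B).
  apply: (@no231_at_cat a [::]) => //; rewrite all_cat; apply/andP; split.
    by apply: sub_all hA => y /andP[/ltnW].
  by apply: sub_all hB => y xy; apply: ltnW (ltn_trans ax xy).
have -> : all (no231_at x a) (A ++ B).
  by apply/allP => z _; rewrite /no231_at (ltnNge x) (ltnW ax) andbF.
rewrite av231_cat ?allAB //; last by move=> y yA; rewrite !inE yA !orbT.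
rewrite no_ddes_cat ?allAB //; last by move=> y; rewrite !inE => /orP[]->; rewrite ?orbT.
(* The descent from [x] to [a] forbids a further descent, but [A] lies above [a]. *)
suff -> : no_ddes true a A = no_ddes false 0 A by case: (av231 A) (av231 B) (no_ddes _ _ A) => [] [] [].
rewrite -[A in LHS]cat0s no_ddes_cat //= allrel_consl; apply/andP; split; last by apply/allrelP.
by apply: sub_all hA => y /andP[].
Qed.


Lemma perm_iota_cat a i j A B x : perm_eq A (iota a.+1 i) -> perm_eq B (iota x.+1 j) ->
  x = a + i.+1 -> perm_eq [:: x, a & A ++ B] (iota a (i.+1 + j).+1).
Proof.
move=> pA pB ex.
have -> : iota a (i.+1 + j).+1 = a :: (iota a.+1 i ++ x :: iota x.+1 j).
  by rewrite ex addSnnS -[LHS]/(a :: iota a.+1 (i + j.+1)) iotaD /= addSnnS.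
apply/seq.permP => P; rewrite /= !count_cat /= (seq.permP pA) (seq.permP pB).
by rewrite addnCA; congr (_ + _); rewrite addnCA.
Qed.

(** If the first letter [x] is not the minimum [a], the second letter [y] must be [a]. Otherwise
    [y > x] gives the 231 pattern [x], [y], [a], while [y < x] forces an ascent to the third letter
    [z], and [y], [z], [a] is a 231 pattern. *)
Lemma words231_uncons a m w : w \in words231 a m.+1 ->
  (exists2 B, B \in words231 a.+1 m & w = a :: B) \/
  (exists i A B, [/\ i < m, A \in words231 a.+1 i, B \in words231 (a + i.+2) (m - i.+1)
     & w = [:: a + i.+1, a & A ++ B]]).
Proof.
rewrite mem_words231 => /andP[gw pw].
have uw : uniq w by rewrite (perm_uniq pw) iota_uniq.
have memw y : (y \in w) = (a <= y < a + m.+1) by rewrite (perm_mem pw) mem_iota.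
case: w => [|x w] in gw pw uw memw *; first by have := perm_size pw.
have [xa|xa] := eqVneq x a.
  subst x; left; exists w => //; rewrite mem_words231.
  move: pw; rewrite /= perm_cons => pw; rewrite pw andbT -(@good231_cons a) //.
  by apply/allP => z; rewrite (perm_mem pw) mem_iota => /andP[].
right.
have /andP[ax xm] : a <= x < a + m.+1 by rewrite -memw mem_head.
have {xa}ax : a < x by rewrite ltn_neqAle eq_sym xa.
have aw : a \in w.
  by have := memw a; rewrite leqnn addnS ltnS leq_addr inE (ltn_eqF ax).
case: w => [|y w] in gw pw uw memw aw *; first by [].
have ya : y = a.
  apply/eqP; apply/idPn => ya; move: aw; rewrite inE eq_sym (negbTE ya) /= => aw.
  have ay : a < y by have := memw y; rewrite !inE eqxx orbT => /esym/andP[ay _]; rewrite ltn_neqAle eq_sym ya.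
  have /and3P[nxyw nyw _] := uw.
  move: gw; rewrite /good231 /= => /andP[/andP[/andP[/allP h1 _] /andP[h2 _]] h3].
  have yx : y < x.
    have := h1 a aw; rewrite /no231_at ax /= -leqNgt leq_eqVlt => /orP[/eqP exy|//].
    by rewrite exy mem_head in nxyw.
  move: h3 h2 aw nyw; rewrite yx; case: w {pw uw memw h1 nxyw} => [|z w] //=.
  rewrite -leqNgt !inE => /andP[yz _] /andP[/allP h2 _] /orP[/eqP az|aw] /norP[nyz _].
    by move: ay; rewrite az ltnNge yz.
  by have := h2 a aw; rewrite /no231_at ay /= ltn_neqAle nyz yz.
subst y; have /and3P[] := uw; rewrite inE negb_or => /andP[_ xw] aw' uw'.
have hsplit : w = [seq y <- w | y < x] ++ [seq y <- w | x < y].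
  by apply: no231_at_split => //; move: gw; rewrite /good231 /= => /andP[/andP[/andP[_ ->]]].
have memw' y : y \in w = [&& y != x, y != a & a <= y < a + m.+1].
  rewrite -memw !inE; case: eqVneq => [->|_]; first by rewrite (negbTE xw).
  by case: eqVneq => [->|_] //=; rewrite (negbTE aw').
have good : good231 [seq y <- w | y < x] && good231 [seq y <- w | x < y].
  rewrite -(@good231_cons2 x a) -?hsplit //.
    by apply/allP => y; rewrite mem_filter memw'; lia.
  exact: filter_all.
case/andP: good => gA gB.
(* The length of [A] is the number of values strictly between [a] and [x]. *)
exists (x - a.+1), [seq y <- w | y < x], [seq y <- w | x < y].
have ex : a + (x - a.+1).+1 = x by lia.
rewrite !mem_words231 gA gB ex -hsplit; split=> //; first by lia.
- apply: uniq_perm; rewrite ?filter_uniq ?iota_uniq // => y.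
  by rewrite mem_filter memw' mem_iota; lia.
apply: uniq_perm; rewrite ?filter_uniq ?iota_uniq // => y.
by rewrite mem_filter memw' mem_iota; lia.
Qed.

Lemma words231_cons a m B : B \in words231 a.+1 m -> a :: B \in words231 a m.+1.
Proof.
rewrite !mem_words231 => /andP[gB pB]; rewrite good231_cons ?gB /= ?perm_cons //.
by apply/allP => z; rewrite (perm_mem pB) mem_iota => /andP[].
Qed.

Lemma words231_cons2 a m i A B : i < m ->
  A \in words231 a.+1 i -> B \in words231 (a + i.+2) (m - i.+1) ->
  [:: a + i.+1, a & A ++ B] \in words231 a m.+1.
Proof.
move=> lim wA wB; rewrite mem_words231 good231_cons2; last 3 first.
- by rewrite addnS ltnS leq_addr.
- by apply/allP => y; rewrite (words231_bounds _ wA); lia.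
- by apply/allP => y; rewrite (words231_bounds _ wB); lia.
move: wA wB; rewrite !mem_words231 => /andP[-> pA] /andP[-> pB].
by rewrite -[m in iota a m.+1](subnKC lim); apply: perm_iota_cat pA _ _ => //; rewrite -addnS.
Qed.

Lemma perm_words231S a m : perm_eq (words231 a m.+1)
  ([seq a :: B | B <- words231 a.+1 m] ++
   [seq [:: a + i.+1, a & AB.1 ++ AB.2] | i <- iota 0 m,
      AB <- [seq (A, B) | A <- words231 a.+1 i, B <- words231 (a + i.+2) (m - i.+1)]]).
Proof.
have uw b k : uniq (words231 b k) by rewrite filter_uniq // permutations_uniq.
apply: uniq_perm => //.
  rewrite cat_uniq map_inj_uniq ?uw => [|? ? []] //=; apply/andP; split.
    apply/hasPn => w /allpairsPdep[i [AB [_ _ ->]]]; apply/mapP => -[B _ []]; lia.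
  apply: allpairs_uniq_dep => [|i _|]; first exact: iota_uniq.
    by apply: allpairs_uniq => //; move=> [? ?] [? ?] _ _ [-> ->].
  move=> p1 p2 /allpairsPdep[i [[A B] [_ /allpairsP[[A1 B1] /= [wA wB [-> ->]]] ->]]].
  move=> /allpairsPdep[j [[A' B'] [_ /allpairsP[[A1' B1'] /= [wA' wB' [-> ->]]] ->]]] /=.
  (* The first letter determines [i], hence the length of [A] and the place of the cut. *)
  case=> /addnI [eij] /eqP; subst j.
  by rewrite eqseq_cat ?(size_words231 wA) ?(size_words231 wA') // => /andP[/eqP-> /eqP->].
move=> w; rewrite mem_cat; apply/idP/orP => [/words231_uncons[[B wB ->]|[i [A [B [lim wA wB ->]]]]]|].
- by left; apply: map_f.
- right; apply/allpairsPdep; exists i, (A, B); split=> //; first by rewrite mem_iota.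
  by apply/allpairsP; exists (A, B).
case=> [/mapP[B wB ->]|/allpairsPdep[i [AB [lim /allpairsP[[A B] /= [wA wB ->]] ->]]]].
  exact: words231_cons.
by apply: words231_cons2; rewrite // mem_iota in lim *.
Qed.

End Words231.

(** * Recursion for 231-avoiding words and first returns of paths *)

Local Open Scope ring_scope.

Lemma triangle_sum (V : nmodType) n (F : nat -> nat -> V) :
  \sum_(i < n) \sum_(a < i) F i a
  = \sum_(a < n) \sum_(k < n - a.+1) F (a + k.+1)%N a.
Proof.
elim: n => [|n IH]; first by rewrite !big_ord0.
rewrite big_ord_recr [RHS]big_ord_recr /= subnn big_ord0 addr0 IH -big_split /=.
apply: eq_bigr => a _; rewrite subSn ?ltn_ord // big_ord_recr /=.
by rewrite -addSnnS subnKC ?ltn_ord.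
Qed.

Section Words231Sum.
Variables (R : comNzRingType) (t q : R).

Definition wordsum231 a m : R :=
  \sum_(w <- words231 a m) t ^+ ndes 0 w * q ^+ drop_sum 0 w.

Lemma wordsum231_0 a : wordsum231 a 0 = 1.
Proof. by rewrite /wordsum231 (_ : words231 a 0 = [:: [::]]) // big_seq1 mulr1. Qed.

(** The descent from [a + i.+1] to [a] contributes [t * q ^+ i.+1]; the other junctions are
    ascents. *)
Lemma wordsum231S a m : wordsum231 a m.+1 = wordsum231 a.+1 m
  + t * \sum_(i < m) q ^+ i.+1 * wordsum231 a.+1 i * wordsum231 (a + i.+2)%N (m - i.+1)%N.
Proof.
rewrite /wordsum231 (perm_big _ (perm_words231S a m)) big_cat big_map /=; congr (_ + _).
  rewrite big_seq [RHS]big_seq; apply: eq_bigr => B wB.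
  have aB : allrel ltn [:: a] B.
    by apply/allrelP => y z; rewrite inE => /eqP->; rewrite (words231_bounds _ wB) => /andP[].
  by rewrite sub0n add0n -[B in LHS]cat0s (ndes_cat aB) (drop_sum_cat aB).
rewrite big_allpairs_dep /= big_distrr /= -[m in iota 0 m]subn0 big_mkord.
apply: eq_bigr => i _; rewrite big_allpairs /= -mulrA big_distrlr /= !big_distrr /=.
rewrite big_seq [RHS]big_seq; apply: eq_bigr => A wA.
rewrite !big_distrr /= big_seq [RHS]big_seq; apply: eq_bigr => B wB.
have AB x : (x < a + i.+2)%N -> allrel ltn (x :: A) B.
  by apply: allrel_words231 wA wB _; lia.
have aA : allrel ltn [:: a] A.
  by apply/allrelP => y z; rewrite inE => /eqP->; rewrite (words231_bounds _ wA) => /andP[].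
rewrite ndes_cat ?AB ?drop_sum_cat ?AB; try lia.
rewrite -[A in ndes a A]cat0s -[A in drop_sum a A]cat0s (ndes_cat aA) (drop_sum_cat aA) /=.
rewrite sub0n !add0n addKn addnS ltnS leq_addr !exprD expr1; ring.
Qed.

(** The coefficients of the recursion do not involve [a], so strong induction on the length
    applies. *)
Lemma wordsum231_shift a m : wordsum231 a m = wordsum231 1 m.
Proof.
elim/ltn_ind: m a => -[|m] IH a; first by rewrite !wordsum231_0.
rewrite !wordsum231S IH // [in RHS]IH //; congr (_ + _ * _); apply: eq_bigr => i _.
have lti : (i < m.+1)%N by rewrite ltnS ltnW.
have ltmi : (m - i.+1 < m.+1)%N by rewrite ltnS leq_subr.
by rewrite (IH i lti a.+1) (IH i lti 2%N) (IH _ ltmi (a + i.+2)%N) (IH _ ltmi (1 + i.+2)%N).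
Qed.

End Words231Sum.

Section Return.
Variables (R : comNzRingType) (t q : R) (G : nat -> R).
Hypothesis G0 : G 0 = 1.
Hypothesis GS : forall n, G n.+1 = G n + t * \sum_(i < n) q ^+ i.+1 * G i * G (n - i.+1)%N.

Local Notation M := (pathsum (weight321 t q 1 0 1)).

Lemma pathsum_motzkinS n h : M n.+1 h =
  q ^+ h * (t * M n h.+1 + M n h + (if h is h'.+1 then M n h' else 0)).
Proof.
rewrite pathsumS /weight321; case: h => [|h] /=; rewrite !expr1n !expr0 !expr1; ring.
Qed.

(* First-return decomposition: a path from height h.+1 to 0 is an excursion of
   length i above h.+1, a down step, and a path from h to 0. *)
Lemma pathsum_return n :
  M n 0 = G n /\ forall h, M n h.+1 = \sum_(i < n) q ^+ (h.+1 * i.+1) * G i * M (n - i.+1)%N h.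
Proof.
elim/ltn_ind: n => -[|n] IH; first by split=> [|h]; rewrite ?G0 ?big_ord0.
have [M0 MS] := IH n (leqnn _).
rewrite pathsum_motzkinS M0 MS addr0 mul1r GS addrC; split.
  congr (_ + _ * _); apply: eq_bigr => i _; rewrite mul1n.
  by have [->] := IH (n - i.+1)%N (leq_subr _ _).
(* The empty excursion matches the down step. For the others, [GS] distinguishes a level from an up
   first step, matching the two remaining terms. *)
move=> h; rewrite pathsum_motzkinS big_ord_recl /= subSS subn0 muln1 G0 mulr1.
rewrite mulrDr addrC; congr (_ + _).
under [RHS]eq_bigr => i _ do rewrite /bump leq0n add1n GS subSS mulrDr mulrDl.
rewrite big_split /= mulrDr [LHS]addrC; congr (_ + _).
  rewrite MS big_distrr /=; apply: eq_bigr => i _.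
  by rewrite (mulnS _ i.+1) exprD; ring.
rewrite MS !big_distrr /=.
under [RHS]eq_bigr => i _ do rewrite mulrCA -mulrA big_distrr /= big_distrl /= big_distrr /=.
(* After an up step two returns follow: an excursion of length [a] above [h.+2], then one of length
   [k] above [h.+1], with [i = a + k.+1]. *)
rewrite (triangle_sum n (fun i a => t * (q ^+ (h.+1 * i.+2) *
   (q ^+ a.+1 * G a * G (i - a.+1)%N) * M (n - i.+1)%N h))).
apply: eq_bigr => a _; have [_ ->] := IH (n - a.+1)%N (leq_subr _ _).
rewrite !big_distrr /=; apply: eq_bigr => k _.
rewrite addnS subSS addKn -!subnDA.
have -> : (h.+1 * (a + k).+3 = h.+1 + h.+1 * a.+1 + h.+1 * k.+1)%N by lia.
have -> : (h.+2 * a.+1 = h.+1 * a.+1 + a.+1)%N by lia.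
rewrite !exprD addSn addnS; ring.
Qed.

End Return.

(** * Permutation statistics on 231-avoiding words, and symmetries *)

Local Open Scope nat_scope.

Lemma av231P (w : seq nat) :
  reflect (forall i j k, i < j -> j < k -> k < size w ->
             ~~ (nth 0 w k < nth 0 w i < nth 0 w j)) (av231 w).
Proof.
elim: w => [|x w IH] /=; first by left.
apply: (iffP andP) => [[/(pairwiseP 0) hx /IH hw]|h]; last first.
  split; last by apply/IH => i j k lij ljk lk; apply: (h i.+1 j.+1 k.+1).
  apply/(pairwiseP 0) => j k; rewrite !inE => _ lk ljk.
  exact: (h 0 j.+1 k.+1).
case=> [|i] [|j] [|k] //=; rewrite !ltnS => lij ljk lk; last exact: hw lk.
by apply: (hx j k); rewrite ?inE //; apply: ltn_trans ljk lk.
Qed.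

Lemma ndesE p (w : seq nat) : ndes p w = \sum_(i < size w) (nth 0 w i < nth 0 (p :: w) i).
Proof.
elim: w p => [|y w IH] p /=; first by rewrite big_ord0.
by rewrite big_ord_recl /= IH; congr (_ + _); apply: eq_bigr.
Qed.

Lemma drop_sumE p (w : seq nat) :
  drop_sum p w = \sum_(i < size w) (nth 0 (p :: w) i - nth 0 w i).
Proof.
elim: w p => [|y w IH] p /=; first by rewrite big_ord0.
by rewrite big_ord_recl /= IH; congr (_ + _); apply: eq_bigr.
Qed.

Lemma no_ddesP (b : bool) p (w : seq nat) :
  reflect ((b -> 0 < size w -> p <= nth 0 w 0) /\
     forall i, i.+1 < size w -> ~~ (nth 0 w i.+1 < nth 0 w i < nth 0 (p :: w) i)) (no_ddes b p w).
Proof.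
elim: w b p => [|y w IH] b p /=; first by left.
apply: (iffP andP) => [[hb /IH[h0 hS]]|[h0 hS]].
  split=> [hb'|[|i] li /=]; first by move: hb; rewrite hb' /= -leqNgt.
    by apply/negP => /andP[wy yp]; have := h0 yp li; rewrite leqNgt wy.
  exact: hS.
split; first by apply/negP => /andP[/h0]; rewrite /= => /(_ isT); lia.
apply/IH; split=> [yp sw|i li]; last exact: (hS i.+1).
by have := hS 0 sw; rewrite /= yp andbT -leqNgt.
Qed.

Lemma sg_leq m (s : 'S_m) i : sg s i <= m.
Proof.
have [lt|le] := ltnP i.-1 m; last by rewrite /sg nth_default // size_pword.
have := mem_nth 0 (_ : i.-1 < size (pword s)); rewrite size_pword => /(_ lt).
by rewrite (perm_mem (pword_perm s)) mem_iota => /andP[]; rewrite add1n ltnS.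
Qed.

Section Stats231.
Variables (m : nat) (s : 'S_m).

Lemma avoids231E : avoids s [:: 2; 3; 1] = av231 (pword s).
Proof.
have nthE (i : 'I_m) : nth 0 (pword s) i = (s i).+1 by rewrite -sgS.
apply/avoids3P/av231P => h.
  move=> i j k lij ljk; rewrite size_pword => lk.
  have lj := ltn_trans ljk lk; have li := ltn_trans lij lj.
  have := h (Ordinal li) (Ordinal lj) (Ordinal lk) lij ljk.
  by rewrite order_iso3 -!nthE /=; lia.
move=> i j k lij ljk; have := h i j k lij ljk.
by rewrite size_pword !nthE order_iso3 => /(_ (ltn_ord k)); lia.
Qed.

Lemma desE : des s = ndes 0 (pword s).
Proof.
rewrite /des count_iv ndesE size_pword; case: m s => [|m'] s' /=; first by rewrite !big_ord0.
by rewrite big_ord_recl /= add0n; apply: eq_bigr.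
Qed.

(** The initial letter 0 of the scan is the convention at position 0; the last position never
    counts, since its successor [m.+1] exceeds all values. *)
Lemma lddE : (ldd s == 0) = no_ddes false 0 (pword s).
Proof.
rewrite /ldd count_iv sum_nat_eq0; apply/forallP/no_ddesP => h.
  split=> // i; rewrite size_pword => li; have := h (Ordinal (ltnW li)).
  rewrite /sgL /= !eqSS (ltn_eqF li) (ltn_eqF (ltnW li)) eqb0.
  by case: i li => [|i] li; rewrite //= ?andbF // eqSS ltn_eqF //; lia.
case=> i li; have [_ {}h] := h; move: h => /(_ i); rewrite size_pword => h.
rewrite /sgL /= !eqSS (ltn_eqF li) eqb0; case: (ltngtP i.+1 m) li => // [l|->] li.
  have := h l.
  by case: i li l {h} => [|i] li l //=; rewrite ?andbF // eqSS ltn_eqF //; lia.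
by apply/negP => /andP[+ _]; have := sg_leq s m; lia.
Qed.

(* In a 231-avoiding word, all the values strictly between the two letters of a
   descent occur after it. *)
Lemma drop_sum_st31_2 : avoids s [:: 2; 3; 1] ->
  drop_sum 0 (pword s) = st31_2 s + des s.
Proof.
move=> /avoids3P av; rewrite desE drop_sumE ndesE size_pword /st31_2 sum_iv.
under [X in _ = X + _]eq_bigr do rewrite count_iv.
case: m s av => [|n] s' av; first by rewrite !big_ord0.
(* The first drop, from 0, and the last index of the pattern count both vanish; what remains ranges
   over adjacent pairs. *)
rewrite [LHS]big_ord_recl [X in _ = X + _]big_ord_recr [X in _ = _ + X]big_ord_recl /=.
rewrite ?sub0n ?ltn0 !add0n [X in _ = _ + X + _]big1 => [|j _]; last first.
  by rewrite ltnNge ltnS (ltnW (ltn_ord j)).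
rewrite addn0 -big_split /=; apply: eq_bigr => i _.
rewrite -[nth 0 _ i]/(sg s' i.+1) -[nth 0 _ (bump 0 i)]/(sg s' (bump 0 i).+1) /bump leq0n add1n.
have li : i < n.+1 by apply: ltnW; rewrite ltnS.
have li' : i.+1 < n.+1 by rewrite ltnS.
rewrite -[i : nat]/(nat_of_ord (Ordinal li)) sgS -[(Ordinal li).+1]/(nat_of_ord (Ordinal li')) sgS.
set I := Ordinal li; set J := Ordinal li'.
have [le|lt] := leqP (s' I) (s' J).
  rewrite ltnS ltnNge le big1 => [|j _]; first by rewrite /= addn0; apply/eqP; rewrite subn_eq0.
  by rewrite sgS; lia.
(* With [s' J] added, the claim counts the values below [s' I]: those at most [s' J], and those in
   between, which avoidance places after the descent. *)
rewrite !ltnS lt subSS; apply: (@addIn (s' J)); rewrite subnK ?(ltnW lt) // -addnA add1n.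
rewrite -[LHS](@sum_perm_lt n.+1 s') ?(ltnW (ltn_ord _)) //.
rewrite -[X in _ + X](@sum_perm_lt n.+1 s' (s' J).+1) ?ltn_ord //.
rewrite -big_split /=; apply: eq_bigr => j _; rewrite sgS !ltnS.
have [l|l|e] := ltngtP j i.
- by have := av j I J l (ltnSn _); rewrite order_iso3; lia.
- have [l'|l'|e] := ltngtP i.+1 j; first by lia.
    by move: l'; rewrite ltnS leqNgt l.
  by rewrite -(ord_inj (e : J = j :> nat)); lia.
by rewrite (ord_inj (e : j = I :> nat)); lia.
Qed.


End Stats231.

(** * Reversal and complementation *)

Lemma sum_ord_pred m (F : nat -> nat) : (forall i, m <= i.+1 -> F i = 0) ->
  \sum_(i < m) F i = \sum_(i < m.-1) F i.
Proof.
case: m => [|m] F0; first by rewrite !big_ord0.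
by rewrite big_ord_recr /= F0 ?addn0.
Qed.

Section Symmetries.
Variable m : nat.
Implicit Type s : 'S_m.

(** Products apply the left factor first: [revp * s] reverses the word, [s * revp] complements its
    values. *)
Definition revp : 'S_m := perm (@rev_ord_inj m).

Lemma revpE (i : 'I_m) : revp i = rev_ord i.
Proof. by rewrite permE. Qed.

Lemma revpK : (revp * revp = 1)%g.
Proof. by apply/permP => i; rewrite permM !revpE rev_ordK perm1. Qed.

Lemma sg_rev s i : 0 < i <= m -> sg (revp * s)%g i = sg s (m.+1 - i).
Proof.
case: i => // i /= li; rewrite -[i]/(nat_of_ord (Ordinal li)) sgS permM revpE.
by rewrite -sgS; congr sg; rewrite /= subSS -subSn.
Qed.

Lemma sg_compl s i : 0 < i <= m -> sg (s * revp)%g i = m.+1 - sg s i.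
Proof.
case: i => // i /= li; rewrite -[i]/(nat_of_ord (Ordinal li)) !sgS permM revpE /=.
by rewrite subSS -subSn.
Qed.

Lemma avoids_rev s p q r : avoids (revp * s)%g [:: r; q; p] = avoids s [:: p; q; r].
Proof.
have iso3_rev x y z : order_iso [:: z; y; x] [:: r; q; p] = order_iso [:: x; y; z] [:: p; q; r].
  by rewrite !order_iso3; do ![case: (_ == _)].
apply/avoids3P/avoids3P => h i j k lij ljk.
  have := h (rev_ord k) (rev_ord j) (rev_ord i); rewrite !permM !revpE !rev_ordK iso3_rev /=.
  by apply; have := ltn_ord k; lia.
have := h (rev_ord k) (rev_ord j) (rev_ord i); rewrite !permM !revpE iso3_rev /=.
by apply; have := ltn_ord k; lia.
Qed.

Lemma avoids_compl s p q r : p <= 3 -> q <= 3 -> r <= 3 ->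
  avoids (s * revp)%g [:: 4 - p; 4 - q; 4 - r] = avoids s [:: p; q; r].
Proof.
move=> p3 q3 r3.
have iso3_compl (i j k : 'I_m) :
    order_iso [:: (rev_ord i).+1; (rev_ord j).+1; (rev_ord k).+1] [:: 4 - p; 4 - q; 4 - r]
    = order_iso [:: i.+1; j.+1; k.+1] [:: p; q; r].
  rewrite !order_iso3 /=; have := ltn_ord i; have := ltn_ord j; have := ltn_ord k; lia.
by apply/avoids3P/avoids3P => h i j k lij ljk; have := h i j k lij ljk;
  rewrite !permM !revpE iso3_compl.
Qed.

Lemma asc_rev s : asc (revp * s)%g = des s.
Proof.
rewrite /asc /des !count_iv (reindex_inj rev_ord_inj) /=; apply: eq_bigr => i _.
have li := ltn_ord i; rewrite !sg_rev; try lia.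
have -> : m.+1 - (m.-1 - i.+1).+1 = i.+2 by lia.
by have -> : m.+1 - (m.-1 - i.+1).+2 = i.+1 by lia.
Qed.

Lemma asc_compl s : asc (s * revp)%g = des s.
Proof.
rewrite /asc /des !count_iv; apply: eq_bigr => i _; have li := ltn_ord i.
rewrite !sg_compl; try lia.
by have := sg_leq s i.+1; have := sg_leq s i.+2; lia.
Qed.

Lemma revp_compl s : (s * revp * revp)%g = s.
Proof. by rewrite -mulgA revpK mulg1. Qed.

Lemma des_compl s : des (s * revp)%g = asc s.
Proof. by rewrite -[in RHS](revp_compl s) asc_compl. Qed.

Lemma sgR_rev s i : i <= m.+1 -> sgR (revp * s)%g i = sgL s (m.+1 - i).
Proof.
move=> le_im; rewrite /sgR /sgL; case: i le_im => [|i] le_im; first by rewrite subn0 /= eqxx.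
rewrite eqSS /=; have [->|ne] := eqVneq i m; first by rewrite subnn.
by rewrite sg_rev //= ?ifN //; lia.
Qed.

(** Infinity is encoded as [m.+1], so complementation also exchanges the two boundary values. *)
Lemma sgR_compl s i : i <= m.+1 -> sgR (s * revp)%g i = m.+1 - sgL s i.
Proof.
move=> le_im; rewrite /sgR /sgL; case: i le_im => [|i] le_im; first by rewrite subn0.
rewrite /= !eqSS; have [_|ne] := eqVneq i m; first by rewrite subnn.
by rewrite sg_compl //; lia.
Qed.

Lemma sgL_leq s i : sgL s i <= m.+1.
Proof. by rewrite /sgL; case: ifP => // _; case: ifP => // _; apply: leqW (sg_leq _ _). Qed.

Lemma rda_rev s : rda (revp * s)%g = ldd s.
Proof.
rewrite /rda /ldd !count_iv (reindex_inj rev_ord_inj) /=; apply: eq_bigr => i _.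
have li := ltn_ord i; rewrite !sgR_rev; try lia.
have -> : m.+1 - (m - i.+1) = i.+2 by lia.
have -> : m.+1 - (m - i.+1).+1 = i.+1 by lia.
by have -> : m.+1 - (m - i.+1).+2 = i by lia.
Qed.

Lemma rda_compl s : rda (s * revp)%g = ldd s.
Proof.
rewrite /rda /ldd !count_iv; apply: eq_bigr => i _; have li := ltn_ord i.
rewrite !sgR_compl /=; try lia.
by have := sgL_leq s i; have := sgL_leq s i.+1; have := sgL_leq s i.+2; lia.
Qed.

Lemma ldd_compl s : ldd (s * revp)%g = rda s.
Proof. by rewrite -[in RHS](revp_compl s) rda_compl. Qed.

Lemma st2_13_rev s : st2_13 (revp * s)%g = st31_2 s.
Proof.
rewrite /st2_13 /st31_2 !sum_iv.
(* Only [m.-1] adjacent pairs exist; the last index is dropped so that reversal acts on the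
   pairs. *)
rewrite (@sum_ord_pred m (fun i => count (fun j => (j < i.+1 < m) &&
  (sg (revp * s)%g i.+1 < sg (revp * s)%g j < sg (revp * s)%g i.+2)) (iv m))); last first.
  by move=> i le_mi; rewrite -(count_pred0 (iv m)); apply: eq_count => j /=; lia.
rewrite (@sum_ord_pred m (fun i => count (fun j => (i.+2 < j) &&
  (sg s i.+2 < sg s j < sg s i.+1)) (iv m))); last first.
  move=> i le_mi; rewrite count_iv big1 // => j _; have := ltn_ord j; lia.
rewrite (reindex_inj rev_ord_inj) /=; apply: eq_bigr => i _; have li := ltn_ord i.
rewrite !count_iv (reindex_inj rev_ord_inj) /=; apply: eq_bigr => j _; have lj := ltn_ord j.
rewrite !sg_rev; try lia.
have -> : m.+1 - (m.-1 - i.+1).+1 = i.+2 by lia.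
have -> : m.+1 - (m.-1 - i.+1).+2 = i.+1 by lia.
have -> : m.+1 - (m - j.+1).+1 = j.+1 by lia.
by congr nat_of_bool; congr (_ && _); lia.
Qed.

Lemma st13_2_compl s : st13_2 (s * revp)%g = st31_2 s.
Proof.
rewrite /st13_2 /st31_2 !sum_iv; apply: eq_bigr => i _; rewrite !count_iv.
apply: eq_bigr => j _; have lj := ltn_ord j; case: (ltnP i.+2 j.+1) => //= lij.
rewrite !sg_compl; try lia.
by have := sg_leq s i.+1; have := sg_leq s i.+2; have := sg_leq s j.+1; lia.
Qed.

Lemma st2_31_compl s : st2_31 (s * revp)%g = st2_13 s.
Proof.
rewrite /st2_13 /st2_31 !sum_iv; apply: eq_bigr => i _; rewrite !count_iv.
apply: eq_bigr => j _; have lj := ltn_ord j; case: (boolP (j.+1 < i.+1 < m)) => //= lij.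
rewrite !sg_compl; try lia.
by have := sg_leq s i.+1; have := sg_leq s i.+2; have := sg_leq s j.+1; lia.
Qed.

End Symmetries.

(** * The gamma expansion *)

Local Open Scope ring_scope.

(** Taking z = 0 keeps exactly the terms with [cda s = 0], as 0 to the power 0 is 1. *)
Lemma sum_avoids321_cda0 (R : comNzRingType) m (u q c : R) :
  \sum_(s : 'S_m | avoids s [:: 3; 2; 1]%N && (cda s == 0%N))
     u ^+ exc s * q ^+ Defs.inv s * c ^+ (m - (exc s).*2)
  = pathsum (weight321 u q 1 0 c) m 0.
Proof.
rewrite -sum_avoids321 big_mkcondr; apply: eq_bigr => s _.
rewrite expr1n mulr1 expr0n; case: eqP => [->|_]; last by rewrite mulr0 mul0r.
by rewrite mulr1 addn0.
Qed.

Lemma sum_avoids231_ldd0 (R : comNzRingType) m (t q : R) :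
  \sum_(s : 'S_m | avoids s [:: 2; 3; 1]%N && (ldd s == 0%N))
     t ^+ des s * q ^+ (st31_2 s + des s)
  = wordsum231 t q 1 m.
Proof.
rewrite /wordsum231 big_filter -(big_pword _ m).
apply: eq_big => s; first by rewrite avoids231E lddE.
by case/andP => av _; rewrite drop_sum_st31_2 // desE.
Qed.

(** Word sums obey the recursion required by [pathsum_return], which identifies them with path sums
    at height 0. *)
Lemma equidistribution_321_231 (R : comNzRingType) m (t q : R) :
  \sum_(s : 'S_m | avoids s [:: 3; 2; 1]%N && (cda s == 0%N)) t ^+ exc s * q ^+ Defs.inv s
  = \sum_(s : 'S_m | avoids s [:: 2; 3; 1]%N && (ldd s == 0%N))
       t ^+ des s * q ^+ (st31_2 s + des s).
Proof.
rewrite sum_avoids231_ldd0.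
have GS n : wordsum231 t q 1 n.+1 = wordsum231 t q 1 n
    + t * \sum_(i < n) q ^+ i.+1 * wordsum231 t q 1 i * wordsum231 t q 1 (n - i.+1)%N.
  rewrite wordsum231S wordsum231_shift; congr (_ + _ * _); apply: eq_bigr => i _.
  by rewrite (wordsum231_shift _ _ 2) (wordsum231_shift _ _ (1 + _)%N).
have [<- _] := pathsum_return (wordsum231_0 t q 1) GS m.
by rewrite -sum_avoids321_cda0; apply: eq_bigr => s _; rewrite expr1n mulr1.
Qed.

Lemma coef_sum_Xn (R : comNzRingType) (I : finType) (P : pred I) (f : I -> nat) (c : I -> R) k :
  (\sum_(i | P i) 'X^(f i) * (c i)%:P)`_k = \sum_(i | P i && (f i == k)) c i.
Proof.
rewrite coef_sum big_mkcondr; apply: eq_bigr => i _.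
by rewrite coefMC coefXn eq_sym; case: eqP; rewrite ?mul1r ?mul0r.
Qed.

Lemma equidistribution_321_231_coef (R : comNzRingType) m k (q : R) :
  \sum_(s : 'S_m | avoids s [:: 3; 2; 1]%N && (cda s == 0%N) && (exc s == k)) q ^+ Defs.inv s
  = \sum_(s : 'S_m | avoids s [:: 2; 3; 1]%N && (ldd s == 0%N) && (des s == k))
       q ^+ (st31_2 s + des s).
Proof.
(* The previous identity is applied over polynomials with t the indeterminate, and coefficients are
   compared. *)
rewrite -(coef_sum_Xn (fun s => avoids s _ && (cda s == 0%N)) (@exc m)).
rewrite -(coef_sum_Xn (fun s => avoids s _ && (ldd s == 0%N)) (@des m)); congr (polyseq _)`_k.
under eq_bigr do rewrite rmorphXn /=; under [RHS]eq_bigr do rewrite rmorphXn /=.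
exact: equidistribution_321_231.
Qed.

Section Gamma.
Variables (F : fieldType) (q : F).
Hypothesis q0 : q != 0.

Lemma gamma321E m k : gamma321 m k q =
  q ^ (m%:Z - k%:Z) *
  \sum_(s : 'S_m | avoids s [:: 3; 2; 1]%N && (cda s == 0%N) && (exc s == k)) q ^+ Defs.inv s.
Proof.
rewrite /gamma321 big_distrr /=; apply: eq_big => [s|s /and3P[_ /eqP-> _]].
  by rewrite -andbA [(exc s == k) && _]andbC.
by rewrite addrAC [LHS]expfzDr.
Qed.

Lemma gamma231E m k : gamma231 m k q =
  q ^ (m%:Z - k%:Z) *
  \sum_(s : 'S_m | avoids s [:: 2; 3; 1]%N && (ldd s == 0%N) && (des s == k))
     q ^+ (st31_2 s + des s).
Proof.
rewrite /gamma231 big_distrr /=; apply: eq_big => [s|s /and3P[_ /eqP-> _]].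
  by rewrite -andbA [(des s == k) && _]andbC.
rewrite ![q ^+ _]exprnP -expfzDr //; congr (_ ^ _); lia.
Qed.

Lemma gamma321_231 m k : gamma321 m k q = gamma231 m k q.
Proof. by rewrite gamma321E gamma231E equidistribution_321_231_coef. Qed.

End Gamma.

Section GammaSymmetries.
Variables (R : comNzRingType) (q : R) (m k : nat).

Lemma gamma132_231 : gamma132 m k q = gamma231 m k q.
Proof.
rewrite /gamma132 (reindex_inj (mulgI (revp m))) /=.
by apply: eq_big => s; rewrite ?avoids_rev ?asc_rev ?rda_rev ?st2_13_rev.
Qed.

Lemma gamma213_231 : gamma213 m k q = gamma231 m k q.
Proof.
rewrite /gamma213 (reindex_inj (mulIg (revp m))) /=.
by apply: eq_big => s; rewrite ?(@avoids_compl m s 2 3 1) ?asc_compl ?rda_compl ?st13_2_compl.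
Qed.

Lemma gamma312_132 : gamma312 m k q = gamma132 m k q.
Proof.
rewrite /gamma312 (reindex_inj (mulIg (revp m))) /=.
by apply: eq_big => s; rewrite ?(@avoids_compl m s 1 3 2) ?des_compl ?ldd_compl ?st2_31_compl.
Qed.

End GammaSymmetries.

(** There are as many excedance values as excedance positions, and without double excedances the two
    sets are disjoint. *)
Lemma exc_cda0_le m (s : 'S_m) : cda s = 0%N -> ((exc s).*2 <= m)%N.
Proof.
move/eqP; rewrite cdaE sum_nat_eq0 => /forallP h.
have e : exc s = (\sum_(i < m) (s^-1%g i < i))%N.
  rewrite excE [RHS](reindex_inj (@perm_inj _ s)) /=.
  by apply: eq_bigr => i _; rewrite permK.
rewrite -addnn [X in (X + _)%N]e excE -big_split /= -[m in leqRHS]card_ord -sum1_card.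
by apply: leq_sum => i _; have := h i; lia.
Qed.

Lemma gamma_sum (F : fieldType) (t q : F) m : q != 0 ->
  \sum_(j < m./2.+1) gamma321 m j q * t ^+ j * (1 + t / q) ^+ (m - j.*2)
  = q ^+ m * pathsum (weight321 (t / q) q 1 0 (1 + t / q)) m 0.
Proof.
move=> q0; rewrite -sum_avoids321_cda0 big_distrr /=.
(* Terms are grouped by [exc]; by [half_le] the truncation [inord] changes nothing on them. *)
rewrite (partition_big (fun s => inord (exc s) : 'I_m./2.+1) xpredT) //=.
have half_le (s : 'S_m) : cda s = 0%N -> (exc s < m./2.+1)%N.
  by move/exc_cda0_le => h; rewrite ltnS -[exc s]doubleK half_leq.
apply: eq_bigr => j _; rewrite gamma321E // big_distrr /= !big_distrl /=.
apply: eq_big => [s|s /andP[_ /eqP->]].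
  case: (boolP (avoids s _ && (cda s == 0%N))) => //= /andP[_ /eqP c0].
  by rewrite -val_eqE /= inordK // half_le.
by rewrite expfzDr // -exprnN -exprnP expr_div_n; ring.
Qed.

Theorem theorem3p14 (R : fieldType) (n : nat) (t q : R) :
  (1 <= n)%N -> q != 0 ->
  Npoly n t q t =
    \sum_(1 <= k < ((n + 1)./2).+1)
       gamma321 n.-1 k.-1 q * t ^+ k * (1 + t / q) ^+ (n + 1 - 2 * k)
  /\ (forall k : nat, (1 <= k <= (n + 1)./2)%N ->
        gamma321 n.-1 k.-1 q = gamma231 n.-1 k.-1 q
     /\ gamma321 n.-1 k.-1 q = gamma312 n.-1 k.-1 q
     /\ gamma321 n.-1 k.-1 q = gamma132 n.-1 k.-1 q
     /\ gamma321 n.-1 k.-1 q = gamma213 n.-1 k.-1 q).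
Proof.
case: n => // m _ q0; split; last first.
  by move=> k _; rewrite gamma312_132 gamma213_231 gamma132_231 gamma321_231.
transitivity (pathsum (weight321 t q t 1 1) m.+1 0).
  by rewrite -sum_avoids321; apply: eq_bigr => s _; rewrite !expr1n !mulr1.
(* The index shift [k = j.+1] absorbs the factor t of the first step. *)
rewrite pathsum_first // -gamma_sum // big_add1 /= addn1 big_mkord /= big_distrr /=.
apply: eq_bigr => j _; rewrite exprS mulnS -mul2n.
have -> : (m.+1 + 1 - (2 + 2 * j) = m - 2 * j)%N by lia.
by ring.
Qed.
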